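(* Let $k\ge 1$, let $\pi_\beta$ be a strictly positive, continuously differentiable density on $\mathbb{R}^k$ that is sub-exponentially light. Suppose there exist $\alpha_1>k$ and $R_1<\infty$ such that $$\frac{\beta}{|\beta|}\cdot\nabla\log\pi_\beta(\beta)\le-\frac{\alpha_1}{|\beta|},\qquad |\beta|>R_1,$$ and that there exist $\alpha_2>k$ and $R_2<\infty$ such that $$\bigl|\nabla\log\pi_\beta(\beta)\bigr|\le\frac{\alpha_2}{|\beta|},\qquad |\beta|>R_2.$$ Let $R\ge0$, $p>2$, $b>0$. Define $f_1,f_2:[0,\infty)\to[0,\infty)$ by $$f_1(x)=\begin{cases}x,&x<R,\\ x+(x-R)^p,&x\ge R,\end{cases}\qquad f_2(x)=\begin{cases}e^{bx}-\frac e3,&x>\frac1b,\\ x^3\frac{b^3e}{6}+x\frac{be}{2},&x\le\frac1b,\end{cases}$$ and for $i=1,2$ define $h_i:\mathbb{R}^k\to\mathbb{R}^k$ by $h_i(\gamma)=f_i(|\gamma|)\,\gamma/|\gamma|$ for $\gamma\neq0$ and $h_i(0)=0$. Let $h=h_2\circ h_1$ (so the change of variable is $\gamma=h_1^{-1}(h_2^{-1}(\beta))$). Then the density $$\pi_\gamma(\gamma)=\pi_\beta\bigl(h(\gamma)\bigr)\,\bigl|\det\nabla h(\gamma)\bigr|,\qquad \gamma\in\mathbb{R}^k,$$ satisfies the curvature condition.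
   Context: $|\cdot|$ denotes the Euclidean norm on $\mathbb{R}^k$, and $\cdot$ between vectors the inner product; $e$ is the base of the natural logarithm. Densities are with respect to Lebesgue measure. $\nabla h(\gamma)$ is the Jacobian matrix of $h$. A strictly positive continuously differentiable density $\pi$ on $\mathbb{R}^k$ is sub-exponentially light if $$\limsup_{|x|\to\infty}\frac{x}{|x|}\cdot\nabla\log\pi(x)=0,$$ and $\pi$ satisfies the curvature condition if $$\limsup_{|x|\to\infty}\frac{x}{|x|}\cdot\frac{\nabla\pi(x)}{|\nabla\pi(x)|}<0.$$ *)

(* Defs.v *)
(* Vectors of R^k are row vectors over R : realType. *)
From HB Require Import structures.
From mathcomp Require Import all_boot all_order all_algebra.
From mathcomp Require Import all_classical all_reals all_analysis.

Set Implicit Arguments.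
Unset Strict Implicit.
Unset Printing Implicit Defensive.

Import Order.TTheory GRing.Theory Num.Theory.
Import numFieldNormedType.Exports.

Local Open Scope classical_set_scope.
Local Open Scope ring_scope.

Section euclidean.
Context {R : realType} {k : nat}.
Implicit Types x y : 'rV[R]_k.

Definition dotp x y : R := \sum_(i < k) x 0 i * y 0 i.

(* The library's norm `|x| on 'rV[R]_k is the sup norm, hence this one. *)
Definition enorm x : R := Num.sqrt (dotp x x).

(* x / |x|, equal to 0 at x = 0 *)
Definition udir x : 'rV[R]_k := (enorm x)^-1 *: x.

Definition enorm_infty : set_system 'rV[R]_k :=
  [set A | exists M : R, forall x, M < enorm x -> A x].

Definition limsup_infty (g : 'rV[R]_k -> R) : \bar R :=
  limf_esup (fun x => (g x)%:E) enorm_infty.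

Definition grad (g : 'rV[R]_k -> R) x : 'rV[R]_k :=
  \row_i 'D_(delta_mx 0 i) g x.

Definition continuously_differentiable (g : 'rV[R]_k -> R) : Prop :=
  (forall x, differentiable g x) /\ continuous (grad g).

End euclidean.

Section lebesgue_tuple.
Context {R : realType}.

Definition lebesgue_cons n (mu : set (n.-tuple (measurableTypeR R)) -> \bar R) :
    set (n.+1.-tuple (measurableTypeR R)) -> \bar R :=
  pushforward (product_measure1 (@lebesgue_measure R) mu)
    (fun z : measurableTypeR R * n.-tuple (measurableTypeR R) =>
       cons_tuple z.1 z.2).

(* k-dimensional Lebesgue measure on the Borel sets of R^k (as k-tuples): the
   library only provides dimension one and binary products. *)
Fixpoint lebesgue_tuple (k : nat) :
    set (k.-tuple (measurableTypeR R)) -> \bar R :=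
  match k with
  | 0%N => \d_[tuple]
  | n.+1 => lebesgue_cons (@lebesgue_tuple n)
  end.

Section lebesgue_cons_measure.
Variables (n : nat).
Variable mu : {sigma_finite_measure
  set (n.-tuple (measurableTypeR R)) -> \bar R}.

Let measurable_cons_tuple : measurable_fun setT
  (fun z : measurableTypeR R * n.-tuple (measurableTypeR R) =>
     cons_tuple z.1 z.2).
Proof. exact: measurable_cons. Qed.

Let measurable_uncons : measurable_fun setT
  (fun t : n.+1.-tuple (measurableTypeR R) => (thead t, [tuple of behead t])).
Proof.
apply/measurable_fun_pair; first exact: measurable_tnth.
exact: measurable_behead.
Qed.

Let cons0 : lebesgue_cons mu set0 = 0%E.
Proof. by rewrite /lebesgue_cons /pushforward preimage_set0 measure0. Qed.

Let cons_ge0 A : (0 <= lebesgue_cons mu A)%E.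
Proof. exact: measure_ge0. Qed.

Let cons_sigma_additive : semi_sigma_additive (lebesgue_cons mu).
Proof.
move=> F mF tF mUF; rewrite /lebesgue_cons /pushforward preimage_bigcup.
apply: measure_semi_sigma_additive.
- by move=> i; rewrite -[X in measurable X]setTI; exact: measurable_cons_tuple.
- apply/trivIsetP => /= i j _ _ ij; rewrite -preimage_setI.
  by move/trivIsetP : tF => /(_ _ _ _ _ ij) ->//; rewrite preimage_set0.
- by rewrite -preimage_bigcup -[X in measurable X]setTI;
    exact: measurable_cons_tuple.
Qed.

HB.instance Definition _ := isMeasure.Build _ _ _ (lebesgue_cons mu)
  cons0 cons_ge0 cons_sigma_additive.

Let cons_sigma_finite : sigma_finite setT (lebesgue_cons mu).
Proof.
have /sigma_finiteP[F [TF ndF Foo]] := sigma_finiteT (@lebesgue_measure R).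
have /sigma_finiteP[G [TG ndG Goo]] := sigma_finiteT mu.
exists (fun m => (fun t : n.+1.-tuple (measurableTypeR R) =>
    (thead t, [tuple of behead t])) @^-1` (F m `*` G m)).
  rewrite -preimage_bigcup (_ : \bigcup_m _ = setT) ?preimage_setT//.
  rewrite -subTset => -[x y] _.
  have [] : (setT : set R) x /\ (setT : set (n.-tuple _)) y by [].
  rewrite TF TG => -[i _ Fix] [j _ Gjy]; exists (maxn i j) => //; split.
  - by move: x Fix; exact/subsetPset/ndF/leq_maxl.
  - by move: y Gjy; exact/subsetPset/ndG/leq_maxr.
move=> m; have [mF Fm] := Foo m; have [mG Gm] := Goo m; split.
  by rewrite -[X in measurable X]setTI; apply: measurable_uncons => //;
    exact: measurableX.
rewrite /lebesgue_cons /pushforward (_ : _ @^-1` _ = F m `*` G m).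
  by rewrite product_measure1E// lte_mul_pinfty// ge0_fin_numE.
apply/seteqP; split=> -[x t] /=; rewrite theadE (_ : [tuple of _] = t)//;
  exact/val_inj.
Qed.

HB.instance Definition _ := Measure_isSigmaFinite.Build _ _ _
  (lebesgue_cons mu) cons_sigma_finite.

End lebesgue_cons_measure.

Lemma lebesgue_tuple_measure k :
  exists mu : {sigma_finite_measure
      set (k.-tuple (measurableTypeR R)) -> \bar R},
    @lebesgue_tuple k = mu.
Proof.
elim: k => [|n [mu IH]] /=; last by rewrite IH; exists (lebesgue_cons mu).
by exists (@dirac _ (0.-tuple (measurableTypeR R)) [tuple] R).
Qed.

Lemma lebesgue_tuple_box k (A : 'I_k -> set (measurableTypeR R)) :
  (forall i, measurable (A i)) ->
  lebesgue_tuple [set t : k.-tuple (measurableTypeR R) |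
      forall i, A i (tnth t i)] = (\prod_(i < k) lebesgue_measure (A i))%E.
Proof.
elim: k A => [|n IH] A mA /=.
  rewrite big_ord0 diracE mem_set//= => -[]//.
rewrite big_ord_recl -IH//; have [mu ->] := lebesgue_tuple_measure n.
have mbox : measurable [set t : n.-tuple (measurableTypeR R) |
    forall i, A (lift ord0 i) (tnth t i)].
  rewrite (_ : mkset _ = \bigcap_(i in setT)
      ((fun t => tnth t i) @^-1` A (lift ord0 i))).
    apply: fin_bigcap_measurable => // i _.
    by rewrite -[X in measurable X]setTI; exact: measurable_tnth.
  by apply/seteqP; split=> t /= tA i; [move=> _; exact: tA|exact: (tA i I)].
rewrite -product_measure1E// /lebesgue_cons /pushforward.
congr product_measure1; apply/seteqP; split=> -[x t] /=.
  by move=> tA; split=> [|i]; [exact: (tA ord0)|have := tA (lift ord0 i);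
    rewrite tnthS].
by move=> [xA tA] i; case: (unliftP ord0 i) => [j ->|->//]; rewrite tnthS.
Qed.

End lebesgue_tuple.

Section densities.
Context {R : realType} {k : nat}.
Implicit Types (pi : 'rV[R]_k -> R) (f : R -> R) (h : 'rV[R]_k -> 'rV[R]_k).

Definition unit_mass pi : Prop :=
  (\int[@lebesgue_tuple R k]_t (pi (\row_i tnth t i))%:E = 1)%E.

Definition positive_C1 pi : Prop :=
  (forall x, 0 < pi x) /\ continuously_differentiable pi.

Definition grad_log pi : 'rV[R]_k -> 'rV[R]_k := grad (fun x => ln (pi x)).

Definition sub_exponentially_light pi : Prop :=
  limsup_infty (fun x => dotp (udir x) (grad_log pi x)) = 0%E.

(* udir v is 0 when v = 0, so points where the gradient vanishes only make this
   condition harder to satisfy. *)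
Definition curvature_condition pi : Prop :=
  (limsup_infty (fun x => dotp (udir x) (udir (grad pi x))) < 0)%E.

Definition radial f (x : 'rV[R]_k) : 'rV[R]_k :=
  if x == 0 then 0 else f (enorm x) *: udir x.

(* ('J h x) is the transpose of the usual Jacobian matrix: the library lets
   matrices act on row vectors from the right. *)
Definition transformed_density pi h (x : 'rV[R]_k) : R :=
  pi (h x) * `|\det ('J h x)|.

End densities.

Section radial_profiles.
Context {R : realType}.

Definition f1 (r p x : R) : R := if x < r then x else x + (x - r) `^ p.

Definition f2 (b x : R) : R :=
  let e := expR 1 in
  if b^-1 < x then expR (b * x) - e / 3
  else x ^+ 3 * (b ^+ 3 * e / 6) + x * (b * e / 2).

End radial_profiles.

(* Main.v *)
From HB Require Import structures.
Require Import Defs.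
From mathcomp Require Import all_boot all_order all_algebra.
From mathcomp Require Import all_classical all_reals all_analysis.
From mathcomp Require Import ring lra.

Set Implicit Arguments.
Unset Strict Implicit.
Unset Printing Implicit Defensive.

Import Order.TTheory GRing.Theory Num.Theory.
Import numFieldNormedType.Exports.

Local Open Scope classical_set_scope.
Local Open Scope ring_scope.

(** The composite change of variable is radial, h(x) = f(|x|) x / |x| with profile
    f = f2 o f1, so everything reduces to functions of one variable.

    Smoothness.  The profile extends to a C^2 function on the line with f(0) = 0,
    f' > 0 and f''(0) = 0 ([profile_radial]).  Hence phi(s) = f(s) / s is positive and
    C^1 with phi'(0) = 0, and so is J(s) = f'(s) phi(s)^(k-1) ([ratio_is_derive],
    [radial_jac_is_derive]).  A C^1 function of |x| whose derivative vanishes at 0 is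
    C^1 on the whole space ([radial_is_diff], [radial_grad_continuous]).  The Jacobian
    matrix of h is phi 1 plus a matrix of rank one, so its determinant is J(|x|) > 0
    ([det_jacobian_radial]), and pi(h(x)) J(|x|) is positive and C^1.

    Curvature.  Write s = |x|, u = x / s and g = grad log pi at h(x).  The gradient of
    the logarithm of the new density has radial component
      A = f' (u . g) + f''/f' + (k-1) (f'/f - 1/s)
    and a tangential component of norm at most phi |g| <= a2 / s, because h preserves
    directions and |h(x)| = f(s).  The hypothesis on u . g gives f' (u . g) <= - a1 f'/f.
    Far out, where f2 is exponential, f''/f' <= f'/f + (p-1) and f'/f >= b (s-r)
    ([profile_far]), so A <= - (a1 - k) b (s-r) + (p-1), which tends to minus infinity
    since a1 > k.  The radial component therefore dominates, and the cosine between
    the gradient and u is eventually at most -1/2 ([cos_transformed_grad_le]). *)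

(** * Derivatives of functions of one real variable *)

Section one_variable.
Context {R : realType}.
Implicit Types (F dF g : R -> R) (a b c x y s t : R).

Lemma is_derive_continuous F dF :
  (forall x, is_derive x 1 F (dF x)) -> continuous F.
Proof.
by move=> dFE x; apply/differentiable_continuous/derivable1_diffP; case: (dFE x).
Qed.

(** The mean value theorem in a form that does not order the two points and
    tolerates a missing derivative at [a]: both features serve when a difference
    quotient at [a] is compared with the derivative nearby. *)
Lemma mvt_dist F dF a b : continuous F ->
  (forall x, x != a -> is_derive x 1 F (dF x)) ->
  exists2 c, `|c - a| <= `|b - a| & F b - F a = dF c * (b - a).
Proof.
move=> cF dFE; have [ab|ba|->] := ltgtP a b; last 1 first.
- by exists b => //; rewrite !subrr mulr0.
- have [x|//|c] := @MVT _ F dF a b ab.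
  + by rewrite in_itv/= => /andP[ax _]; apply: dFE; rewrite gt_eqF.
  + exact: continuous_subspaceT.
  + rewrite in_itv/= => /andP[ac cb] e; exists c => //.
    by rewrite !gtr0_norm ?subr_gt0// lerD2r ltW.
- have [x|//|c] := @MVT _ F dF b a ba.
  + by rewrite in_itv/= => /andP[_ xa]; apply: dFE; rewrite lt_eqF.
  + exact: continuous_subspaceT.
  + rewrite in_itv/= => /andP[bc ca] e; exists c => //.
      by rewrite !ltr0_norm ?subr_lt0// lerN2 lerD2r ltW.
    by rewrite -opprB e -mulrN opprB.
Qed.

(** By the mean value theorem, the difference quotients at [c] are values of [dF]
    at points closer and closer to [c].  This settles every exceptional point met
    below: the seams of the two profiles and the origin. *)
Lemma derive_extend F dF c : continuous F ->
  (forall x, x != c -> is_derive x 1 F (dF x)) -> {for c, continuous dF} ->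
  is_derive c 1 F (dF c).
Proof.
move=> cF dFE cdF.
have dq : h^-1 *: ((F \o shift c) h%:A - F c) @[h --> 0^'] --> dF c.
  apply/cvgrPdist_le => e e0.
  move/cvgrPdist_le : cdF => /(_ _ e0) /nbhs_ballP[d /= d0 dH].
  near=> h.
  have h0 : h != 0 by near: h; exact: nbhs_dnbhs_neq.
  have [x xh /= E] := @mvt_dist F dF c (h + c) cF dFE.
  rewrite /= [h%:A]mulr1 E addrK [_ *: _]mulrC mulfK//.
  apply: dH; rewrite /ball/= distrC (le_lt_trans xh)// addrK.
  by near: h; apply: dnbhs0_lt.
apply: DeriveDef; first by apply/cvg_ex; exists (dF c).
exact/cvg_lim.
Unshelve. all: by end_near. Qed.

Lemma glue_continuous c (g1 g2 : R -> R) : continuous g1 -> continuous g2 ->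
  g1 c = g2 c -> continuous (fun x => if c < x then g2 x else g1 x).
Proof.
move=> c1 c2 e12 x.
(* Each branch is frozen at its seam value on the other side, so that no case
   distinction remains. *)
rewrite (_ : (fun x => _) = fun x => g1 (Num.min x c) + g2 (Num.max x c) - g1 c).
  apply: cvgB; last exact: cvg_cst.
  apply: cvgD.
    apply: (@continuous_comp _ _ _ (fun x => Num.min x c) g1); last exact: c1.
    by apply: (@continuous_min _ _ id (cst c)); [exact: cvg_id|exact: cvg_cst].
  apply: (@continuous_comp _ _ _ (fun x => Num.max x c) g2); last exact: c2.
  by apply: (@continuous_max _ _ id (cst c)); [exact: cvg_id|exact: cvg_cst].
apply/funext => y; case: ltP => cy.
  by rewrite addrAC subrr add0r.
by rewrite -e12 addrK.
Qed.

Lemma glue_is_derive c (g1 g2 dg1 dg2 : R -> R) :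
  (forall x, is_derive x 1 g1 (dg1 x)) -> (forall x, is_derive x 1 g2 (dg2 x)) ->
  continuous dg1 -> continuous dg2 -> g1 c = g2 c -> dg1 c = dg2 c ->
  forall x, is_derive x 1 (fun x => if c < x then g2 x else g1 x)
                          (if c < x then dg2 x else dg1 x).
Proof.
move=> d1 d2 c1 c2 e de.
have off x : x != c -> is_derive x 1 (fun x => if c < x then g2 x else g1 x)
    (if c < x then dg2 x else dg1 x).
  case: (ltgtP c x) => // cx _.
    apply: near_eq_is_derive (d2 x); near=> y.
    by rewrite (_ : c < y)//; near: y; exact: lt_nbhsr.
  apply: near_eq_is_derive (d1 x); near=> y.
  by rewrite ltNge (_ : y <= c)//; apply: ltW; near: y; exact: lt_nbhsl.
move=> x; have [->|/off//] := eqVneq x c.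
apply: derive_extend off _.
  exact: glue_continuous (is_derive_continuous d1) (is_derive_continuous d2) e.
exact: glue_continuous.
Unshelve. all: by end_near. Qed.

(** The truncated power t_+ ^ a, cut at 0 because [t `^ a] is 1 for negative t. *)
Definition pospow a t : R := if t < 0 then 0 else t `^ a.

Lemma pospow_ge0 a t : 0 <= pospow a t.
Proof. by rewrite /pospow; case: ifP => // _; exact: powR_ge0. Qed.

Lemma pospow_le0 a t : a != 0 -> t <= 0 -> pospow a t = 0.
Proof.
by move=> a0; rewrite le_eqVlt /pospow => /predU1P[->|->//]; rewrite ltxx powR0.
Qed.

Lemma pospow_near a t : 0 < t -> \forall y \near t, y `^ a = pospow a y.
Proof.
move=> t0; near=> y; rewrite /pospow ltNge ltW//=.
by near: y; exact: lt_nbhsr.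
Unshelve. all: by end_near. Qed.

Lemma pospow_near0 a t : t < 0 -> \forall y \near t, cst 0 y = pospow a y.
Proof.
move=> t0; near=> y; rewrite /pospow (_ : y < 0)//.
by near: y; exact: lt_nbhsl.
Unshelve. all: by end_near. Qed.

Lemma pospow_continuous a : 0 < a -> continuous (pospow a).
Proof.
move=> a0 t; have [t0|t0|->] := ltgtP t 0.
- rewrite /continuous_at pospow_le0 ?gt_eqF ?ltW//.
  by apply: cvg_trans (near_eq_cvg (pospow_near0 a t0)) _; exact: cvg_cst.
- apply: cvg_trans (near_eq_cvg (pospow_near a t0)) _.
  rewrite -(nbhs_singleton (pospow_near a t0)).
  apply: (differentiable_continuous (f := fun y => y `^ a)).
  by apply/derivable1_diffP; have [] := is_derive1_powR a t0.
- rewrite /continuous_at pospow_le0 ?gt_eqF//; apply/cvgrPdist_le => e e0.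
  near=> y; rewrite sub0r normrN ger0_norm ?pospow_ge0// /pospow.
  case: ltP => [_|y0]; first exact: ltW.
  (* t ^ a <= e as soon as t <= e ^ (1 / a). *)
  rewrite (_ : e = (e `^ a^-1) `^ a); last first.
    by rewrite -powRrM mulVf ?gt_eqF// powRr1// ltW.
  apply: ge0_ler_powR; rewrite ?nnegrE ?powR_ge0//; first exact: ltW.
  by apply: ltW; near: y; apply: lt_nbhsl; exact: powR_gt0.
Unshelve. all: by end_near. Qed.

Lemma pospow_is_derive a t : 1 < a ->
  is_derive t 1 (pospow a) (a * pospow (a - 1) t).
Proof.
move=> a1.
have off x : x != 0 -> is_derive x 1 (pospow a) (a * pospow (a - 1) x).
  case: (ltgtP x 0) => // x0 _.
  - apply: (near_eq_is_derive (f := cst 0)); first exact: pospow_near0.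
    rewrite pospow_le0 ?mulr0; [exact: is_derive_cst| |exact: ltW].
    by rewrite gt_eqF// subr_gt0.
  - apply: (near_eq_is_derive (f := (fun y => y `^ a))); first exact: pospow_near.
    rewrite -(nbhs_singleton (pospow_near _ x0)).
    exact: is_derive1_powR.
have [->|/off//] := eqVneq t 0.
apply: (derive_extend (dF := fun t => a * pospow (a - 1) t)) off _.
  by apply: pospow_continuous; rewrite (lt_trans _ a1).
apply: cvgM; first exact: cvg_cst.
by apply: pospow_continuous; rewrite subr_gt0.
Qed.

End one_variable.

(** * Radial profiles *)

(** A profile extended to the whole line.  The condition [d2f 0 = 0] is what makes
    functions of the Euclidean norm built from [f s / s] and [df s] differentiable
    at the origin: their derivatives in the radius must vanish there. *)
Record radial_profile {R : realType} (f df d2f : R -> R) : Prop := RadialProfile {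
  rp0 : f 0 = 0;
  rp_is_derive : forall s : R, is_derive s 1 f (df s);
  rp_is_derive2 : forall s : R, is_derive s 1 df (d2f s);
  rp_continuous2 : continuous d2f;
  rp_derive2_0 : d2f 0 = 0;
  rp_derive_gt0 : forall s : R, 0 < df s }.

Section ratio.
Context {R : realType}.
Implicit Types (s t x : R).
Variables f df d2f : R -> R.
Hypothesis fP : radial_profile f df d2f.

Let f0 : f 0 = 0 := rp0 fP.
Let fE s : is_derive s 1 f (df s) := rp_is_derive fP s.
Let dfE s : is_derive s 1 df (d2f s) := rp_is_derive2 fP s.

(** The scalar field in radial f x = (f |x| / |x|) x. *)
Definition ratio s := if s == 0 then df 0 else f s / s.

Definition dratio s := if s == 0 then 0 else (s * df s - f s) / s ^+ 2.

Lemma ratioM s : ratio s * s = f s.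
Proof. by rewrite /ratio; case: eqVneq => [->|s0]; rewrite ?mulr0 ?divfK. Qed.

Lemma ratio_dratio s : ratio s + s * dratio s = df s.
Proof.
rewrite /ratio /dratio; case: eqVneq => [->|s0]; first by rewrite mul0r addr0.
by field.
Qed.

Lemma ratio_gt0 s : 0 < ratio s.
Proof.
have df_gt0 := rp_derive_gt0 fP; rewrite /ratio; case: eqVneq => [//|s0].
have [c _] := @mvt_dist _ f df 0 s (is_derive_continuous fE) (fun x _ => fE x).
by rewrite f0 !subr0 => ->; rewrite mulfK.
Qed.

(** The numerator s f'(s) - f(s) vanishes at 0 and has derivative s f''(s), so by
    the mean value theorem the quotient by s^2 is at most |f''| between 0 and s. *)
Lemma dratio_continuous0 : {for 0, continuous dratio}.
Proof.
rewrite /prop_for /continuous_at {2}/dratio eqxx; apply/cvgrPdist_le => e e0.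
have /cvgrPdist_le/(_ e e0)/nbhs_ballP[d /= d0 dH] := @rp_continuous2 _ _ _ _ fP 0.
apply/nbhs_ballP; exists d => //= s; rewrite /ball/= sub0r normrN => sd.
rewrite sub0r normrN /dratio; case: eqVneq => [_|s0].
  by rewrite normr0 ltW.
have numE (x : R) : is_derive x 1 (fun y => y * df y - f y) (x * d2f x).
  have := fE x; have := dfE x => ? ?.
  apply: is_derive_eq; rewrite /GRing.scale/=; ring.
have [c] := @mvt_dist _ (fun y => y * df y - f y) (fun x => x * d2f x) 0 s
  (is_derive_continuous numE) (fun x _ => numE x).
rewrite f0 mul0r !subr0 => cs ->.
rewrite expr2 invfM mulrA mulfK// normrM normrM normfV mulrAC.
apply: (@le_trans _ _ `|d2f c|).
  by apply: ler_piMl => //; rewrite ler_pdivrMr ?mul1r// normr_gt0.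
have := dH c; rewrite /= (rp_derive2_0 fP) sub0r normrN; apply.
by rewrite /ball/= sub0r normrN (le_lt_trans cs).
Qed.

Lemma ratio_is_derive s : is_derive s 1 ratio (dratio s).
Proof.
have off (x : R) : x != 0 -> is_derive x 1 ratio (dratio x).
  move=> x0; have := fE x => ?.
  have Vx : is_derive x 1 (fun y => y^-1) (- x ^- 2).
    have := @is_deriveV _ id x 1 1 x0 (is_derive_id _ _).
    by rewrite /GRing.scale/= mulr1.
  apply: (near_eq_is_derive (f := fun y => f y / y)).
    near=> y; rewrite /ratio ifF//; apply/negbTE.
    by near: y; exact: (cvgr_neq0 x).
  apply: is_derive_eq; rewrite /dratio (negbTE x0) /GRing.scale/=; field.
  by [].
have [->|/off//] := eqVneq s 0.
apply: (derive_extend _ off dratio_continuous0) => x.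
have [->|x0] := eqVneq x 0; last first.
  by apply/differentiable_continuous/derivable1_diffP; case: (off x x0).
rewrite /continuous_at {2}/ratio eqxx; apply/cvgrPdist_le => e e0.
have /cvgrPdist_le/(_ e e0)/nbhs_ballP[d /= d0 dH] := @is_derive_continuous _ _ _ dfE 0.
apply/nbhs_ballP; exists d => //= t; rewrite /ball/= sub0r normrN => td.
rewrite /ratio; case: eqVneq => [_|t0].
  by rewrite subrr normr0 ltW.
have [c] := @mvt_dist _ f df 0 t (is_derive_continuous fE) (fun x _ => fE x).
rewrite f0 !subr0 => ct ->; rewrite mulfK//; apply: dH.
by rewrite /ball/= sub0r normrN (le_lt_trans ct).
Unshelve. all: by end_near. Qed.

Lemma dratio_continuous : continuous dratio.
Proof.
move=> x; have [->|x0] := eqVneq x 0; first exact: dratio_continuous0.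
have : {for x, continuous (fun s => (s * df s - f s) / s ^+ 2)}.
  apply: cvgM; last by apply: cvgV; rewrite ?expf_neq0//; exact: exprn_continuous.
  apply: cvgB; last exact: is_derive_continuous fE _.
  by apply: cvgM; [exact: cvg_id|exact: is_derive_continuous dfE x].
have E : \forall y \near x, (y * df y - f y) / y ^+ 2 = dratio y.
  near=> y; rewrite /dratio ifF//; apply/negbTE.
  by near: y; exact: (cvgr_neq0 x).
rewrite /prop_for /continuous_at (nbhs_singleton E); apply: cvg_trans.
exact: near_eq_cvg.
Unshelve. all: by end_near. Qed.

End ratio.

(** * The profile of the composite change of variable *)

Section profiles.
Context {R : realType}.
Variables r p b : R.
Hypotheses (r_ge0 : 0 <= r) (p_gt2 : 2 < p) (b_gt0 : 0 < b).
Implicit Types s t x y : R.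

Definition df1 s := 1 + p * pospow (p - 1) (s - r).

Definition d2f1 s := p * ((p - 1) * pospow (p - 2) (s - r)).

(** The truncated power makes sense on the whole line, so that r = 0, where the
    seam sits at the origin, is no special case. *)
Lemma f1E s : f1 r p s = s + pospow p (s - r).
Proof. by rewrite /f1 /pospow subr_lt0; case: ifP; rewrite ?addr0. Qed.

Let pospow_shift_is_derive a s : 1 < a ->
  is_derive s 1 (fun t => pospow a (t - r)) (a * pospow (a - 1) (s - r)).
Proof.
move=> a1; have := @pospow_is_derive R a (s - r) a1 => ?.
have := @is_derive1_comp R (pospow a) (fun t => t - r) s (a * pospow (a - 1) (s - r)) 1.
rewrite mulr1; apply => //.
by apply: is_derive_eq; rewrite oppr0 addr0.
Qed.

Lemma f1_is_derive s : is_derive s 1 (f1 r p) (df1 s).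
Proof.
rewrite (_ : f1 r p = fun s => s + pospow p (s - r)); last exact/funext/f1E.
have p1 : 1 < p by move: p_gt2 => ?; lra.
have := pospow_shift_is_derive s p1 => ?.
exact: is_derive_eq.
Qed.

Lemma df1_is_derive s : is_derive s 1 df1 (d2f1 s).
Proof.
have p1 : 1 < p - 1 by move: p_gt2 => ?; lra.
have := pospow_shift_is_derive s p1 => ?.
rewrite /df1 /d2f1; apply: is_derive_eq.
by rewrite (_ : p - 2 = p - 1 - 1) /GRing.scale/=; ring.
Qed.

Lemma d2f1_continuous : continuous d2f1.
Proof.
move=> s; apply: cvgM; first exact: cvg_cst.
apply: cvgM; first exact: cvg_cst.
apply: (@continuous_comp _ _ _ (fun s => s - r) (pospow (p - 2))).
  by apply: cvgB; [exact: cvg_id|exact: cvg_cst].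
by apply: pospow_continuous; move: p_gt2 => ?; lra.
Qed.

Lemma f1_0 : f1 r p 0 = 0.
Proof.
move: p_gt2 r_ge0 => ? ?.
by rewrite f1E pospow_le0 ?addr0 ?gt_eqF//; lra.
Qed.

Lemma d2f1_0 : d2f1 0 = 0.
Proof.
move: p_gt2 r_ge0 => ? ?.
by rewrite /d2f1 pospow_le0 ?mulr0 ?gt_eqF//; lra.
Qed.

Lemma df1_ge1 s : 1 <= df1 s.
Proof.
by rewrite lerDl mulr_ge0 ?pospow_ge0//; move: p_gt2 => ?; lra.
Qed.

Lemma f1_ge s : s <= f1 r p s.
Proof. by rewrite f1E lerDl pospow_ge0. Qed.

(** Once s - r >= 1, a larger exponent gives a larger power. *)
Lemma df1_far s : r + 1 <= s -> s - r <= df1 s /\ d2f1 s <= (p - 1) * df1 s.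
Proof.
move: p_gt2 r_ge0 => ? ? rs; have s1 : 1 <= s - r by lra.
have pw a : pospow a (s - r) = (s - r) `^ a by rewrite /pospow ifF//; lra.
rewrite /df1 /d2f1 !pw.
have h1 : s - r <= (s - r) `^ (p - 1) by apply: le1r_powR => //; lra.
have h2 : (s - r) `^ (p - 2) <= (s - r) `^ (p - 1) by apply: ler_powR => //; lra.
split; first by nra.
rewrite mulrCA ler_wpM2l ?subr_ge0//; first by lra.
by apply: ler_wpDl; rewrite // ler_wpM2l//; lra.
Qed.

Let e : R := expR 1.

Definition df2 x := if b^-1 < x then b * expR (b * x)
  else x ^+ 2 * (b ^+ 3 * e / 2) + b * e / 2.

Definition d2f2 x := if b^-1 < x then b ^+ 2 * expR (b * x) else x * (b ^+ 3 * e).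

Let exp_is_derive x : is_derive x 1 (fun y => expR (b * y)) (b * expR (b * x)).
Proof.
have := @is_derive1_comp R expR (fun t => b * t) x (expR (b * x)) b.
rewrite [expR _ * b]mulrC; apply.
by apply: is_derive_eq; rewrite /GRing.scale/= mulr1 ?mulr0 ?addr0.
Qed.

Let bbV : b * b^-1 = 1. Proof. by rewrite divff ?gt_eqF. Qed.

Let cub1_is_derive x : is_derive x 1
  (fun x => x ^+ 3 * (b ^+ 3 * e / 6) + x * (b * e / 2))
  (x ^+ 2 * (b ^+ 3 * e / 2) + b * e / 2).
Proof. by apply: is_derive_eq; rewrite /GRing.scale/=; field. Qed.

Let cub2_is_derive x : is_derive x 1
  (fun x => x ^+ 2 * (b ^+ 3 * e / 2) + b * e / 2) (x * (b ^+ 3 * e)).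
Proof. by apply: is_derive_eq; rewrite /GRing.scale/=; field. Qed.

Let cub3_is_derive x : is_derive x 1 (fun x => x * (b ^+ 3 * e)) (b ^+ 3 * e).
Proof. by apply: is_derive_eq; rewrite /GRing.scale/=; ring. Qed.

Let exp1_is_derive x :
  is_derive x 1 (fun y => expR (b * y) - e / 3) (b * expR (b * x)).
Proof.
by have := exp_is_derive x => ?; apply: is_derive_eq; rewrite oppr0 addr0.
Qed.

Let exp2_is_derive x :
  is_derive x 1 (fun y => b * expR (b * y)) (b ^+ 2 * expR (b * x)).
Proof.
have := exp_is_derive x => ?; apply: is_derive_eq.
by rewrite /GRing.scale/=; ring.
Qed.

Let exp3_continuous : continuous (fun y => b ^+ 2 * expR (b * y)).
Proof.
move=> y; apply: cvgM; first exact: cvg_cst.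
exact: is_derive_continuous exp_is_derive y.
Qed.

(** The constants of [f2] make value, slope and second derivative of the two branches
    agree at 1 / b. *)
Lemma f2_is_derive x : is_derive x 1 (f2 b) (df2 x).
Proof.
apply: (glue_is_derive cub1_is_derive exp1_is_derive
  (is_derive_continuous cub2_is_derive) (is_derive_continuous exp2_is_derive)).
- by rewrite /= bbV -/e; field; rewrite gt_eqF.
- by rewrite /= bbV -/e; field; rewrite gt_eqF.
Qed.

Lemma df2_is_derive x : is_derive x 1 df2 (d2f2 x).
Proof.
apply: (glue_is_derive cub2_is_derive exp2_is_derive
  (is_derive_continuous cub3_is_derive) exp3_continuous).
- by rewrite /= bbV -/e; field; rewrite gt_eqF.
- by rewrite /= bbV -/e; field; rewrite gt_eqF.
Qed.

Lemma d2f2_continuous : continuous d2f2.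
Proof.
apply: glue_continuous (is_derive_continuous cub3_is_derive) exp3_continuous _.
by rewrite /= bbV -/e; field; rewrite gt_eqF.
Qed.

Lemma f2_0 : f2 b 0 = 0.
Proof. by rewrite /f2 ifF ?expr0n/= ?mul0r ?addr0// ltNge invr_ge0 ltW. Qed.

Lemma d2f2_0 : d2f2 0 = 0.
Proof. by rewrite /d2f2 ifF ?mul0r// ltNge invr_ge0 ltW. Qed.

Lemma df2_gt0 x : 0 < df2 x.
Proof.
rewrite /df2; have e0 : 0 < e := expR_gt0 1.
case: ifP => _; first by rewrite mulr_gt0 ?expR_gt0.
apply: ltr_wpDl; last by rewrite divr_gt0 ?mulr_gt0.
by rewrite mulr_ge0 ?sqr_ge0// divr_ge0 ?mulr_ge0 ?exprn_ge0// ltW.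
Qed.

Lemma f2_far x : b^-1 < x ->
  [/\ 0 < f2 b x, b * f2 b x <= df2 x & d2f2 x = b * df2 x].
Proof.
move=> bx; rewrite /f2 /df2 /d2f2 bx.
have e0 : 0 < e := expR_gt0 1.
have : e < expR (b * x) by rewrite ltr_expR -ltr_pdivrMl ?mulr1.
rewrite -/e => h; split; first by lra.
- by rewrite ler_pM2l//; lra.
- by rewrite expr2 mulrA.
Qed.

Definition profile s := f2 b (f1 r p s).
Definition dprofile s := df2 (f1 r p s) * df1 s.
Definition d2profile s := d2f2 (f1 r p s) * df1 s ^+ 2 + df2 (f1 r p s) * d2f1 s.

Lemma profile_is_derive s : is_derive s 1 profile (dprofile s).
Proof.
exact: is_derive1_comp (f2_is_derive _) (f1_is_derive s).
Qed.

Lemma dprofile_is_derive s : is_derive s 1 dprofile (d2profile s).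
Proof.
have := @is_derive1_comp R df2 (f1 r p) s _ _ (df2_is_derive _) (f1_is_derive s).
have := df1_is_derive s => ? ?.
rewrite /dprofile /d2profile; apply: is_derive_eq; rewrite /GRing.scale/=; ring.
Qed.

Lemma d2profile_continuous : continuous d2profile.
Proof.
have f1c := is_derive_continuous f1_is_derive.
move=> s; apply: cvgD; apply: cvgM.
- apply: (@continuous_comp _ _ _ (f1 r p) d2f2); first exact: f1c.
  exact: d2f2_continuous.
- apply: (@continuous_comp _ _ _ df1 (fun x => x ^+ 2)).
    exact: is_derive_continuous df1_is_derive _.
  exact: exprn_continuous.
- apply: (@continuous_comp _ _ _ (f1 r p) df2); first exact: f1c.
  exact: is_derive_continuous df2_is_derive _.
- exact: d2f1_continuous.
Qed.

Lemma profile_0 : profile 0 = 0. Proof. by rewrite /profile f1_0 f2_0. Qed.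

Lemma d2profile_0 : d2profile 0 = 0.
Proof. by rewrite /d2profile f1_0 d2f2_0 d2f1_0 mul0r mulr0 addr0. Qed.

Lemma dprofile_gt0 s : 0 < dprofile s.
Proof. by rewrite mulr_gt0 ?df2_gt0// (lt_le_trans ltr01) ?df1_ge1. Qed.

Lemma profile_radial : radial_profile profile dprofile d2profile.
Proof.
split; [exact: profile_0|exact: profile_is_derive|exact: dprofile_is_derive| | |].
- exact: d2profile_continuous.
- exact: d2profile_0.
- exact: dprofile_gt0.
Qed.

(** Beyond 1 / b the outer profile is an exponential up to a constant, so f''/f' is
    b f1' + f1''/f1' and f'/f is at least b f1'.  Hence f''/f' exceeds f'/f by at most
    f1''/f1', which is bounded, while f'/f grows at least linearly. *)
Lemma profile_far s : b^-1 < s -> r + 1 <= s ->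
  [/\ b * (s - r) <= dprofile s / profile s &
      d2profile s / dprofile s <= dprofile s / profile s + (p - 1)].
Proof.
move=> bs rs; move: p_gt2 r_ge0 b_gt0 => ? ? ?; have [hr1 hr2] := df1_far rs.
have /f2_far[f20 h1 h2] : b^-1 < f1 r p s by exact: lt_le_trans (f1_ge s).
have d10 : 0 < df1 s by exact: lt_le_trans (df1_ge1 s).
have bf : b <= df2 (f1 r p s) / f2 b (f1 r p s) by rewrite ler_pdivlMr.
have E : dprofile s / profile s = df2 (f1 r p s) / f2 b (f1 r p s) * df1 s.
  by rewrite /dprofile /profile mulrAC.
have E2 : d2profile s / dprofile s = b * df1 s + d2f1 s / df1 s.
  rewrite /d2profile /dprofile h2; field.
  by rewrite !gt_eqF ?df2_gt0.
split; first by rewrite E; apply: ler_pM => //; [exact: ltW|lra].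
rewrite E E2 lerD// ?ler_pM2r//.
by rewrite ler_pdivrMr.
Qed.

End profiles.

Lemma profile_ge (R : realType) (r p b s : R) : 0 < b -> b^-1 < s ->
  b * s - expR 1 <= profile r p b s.
Proof.
move=> b0 bs; have sf := f1_ge r p s; rewrite /profile /f2 (lt_le_trans bs sf).
have e0 := expR_gt0 (1 : R).
have := expR_ge1Dx (b * f1 r p s).
have : b * s <= b * f1 r p s by rewrite ler_pM2l.
lra.
Qed.

(** * Differentiability in normed spaces *)

Section frechet.
Context {R : realType} {V W : normedModType R}.

Lemma is_diff_epsilon (f df : V -> W) (x : V) : linear df -> continuous df ->
  (forall e, 0 < e ->
    \forall v \near 0, `|f (v + x) - f x - df v| <= e * `|v|) ->
  is_diff x f df.
Proof.
move=> dfl dfc H.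
pose lM := GRing.isLinear.Build _ _ _ _ _ dfl.
pose L : {linear _ -> _} := HB.pack df lM.
have E : f \o shift x = cst (f x) + L +o_ 0 id.
  apply/eqaddoP => e e0; near=> v; rewrite /= opprD addrA.
  by near: v; exact: H.
have Ed : 'd f x = L :> (V -> W) by exact: diff_unique.
apply: DiffDef => //; apply/diff_locallyP; rewrite Ed; split => //.
Unshelve. all: by end_near. Qed.

(** At a zero of [c] a bounded, possibly discontinuous, [u] does no harm. *)
Lemma scale_bounded_continuous (T : topologicalType) (c : T -> R) (u : T -> V)
    (t : T) :
  {for t, continuous c} -> c t = 0 -> (forall y, `|u y| <= 1) ->
  {for t, continuous (fun y => c y *: u y)}.
Proof.
rewrite /prop_for /continuous_at => cc ct u1; rewrite ct scale0r.
move: cc; rewrite ct => /cvgrPdist_le cc.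
apply/cvgrPdist_le => e /cc; apply: filterS => y.
by rewrite !sub0r !normrN normrZ; apply: le_trans; rewrite ler_piMr.
Qed.

(** [continuousD] for sums that are not written as sums of functions. *)
Lemma continuous_add (T : topologicalType) (F G : T -> V) (t : T) :
  {for t, continuous F} -> {for t, continuous G} ->
  {for t, continuous (fun y => F y + G y)}.
Proof. exact: continuousD. Qed.

Fact scale_is_bilinear :
  bilinear_for
    (GRing.Scale.Law.clone _ _ *:%R _) (GRing.Scale.Law.clone _ _ *:%R _)
    (@GRing.scale R V).
Proof.
split=> [u'|u] a x y /=; first by rewrite scalerDl scalerA.
by rewrite scalerDr !scalerA mulrC.
Qed.

HB.instance Definition _ := bilinear_isBilinear.Build R R V V _ _
  (@GRing.scale R V) scale_is_bilinear.

Lemma is_diff_scale_id (c dc : V -> R) (x : V) : is_diff x c dc ->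
  is_diff x (fun y => c y *: y) (fun v => c x *: v + dc v *: x).
Proof.
move=> dcx.
have sc := @scale_continuous R V.
have bx : is_diff (c x, x) (fun q : R * V => q.1 *: q.2)
    (fun q => c x *: q.2 + q.1 *: x).
  apply: DiffDef.
    exact: (@differentiable_bilin _ _ _ _ (@GRing.scale R V)).
  exact: (@diff_bilin _ _ _ _ (@GRing.scale R V)).
have -> : (fun y => c y *: y) = (fun q : R * V => q.1 *: q.2) \o (fun y => (c y, y)).
  by [].
exact: is_diff_eq.
Qed.

End frechet.

(** * Euclidean geometry and radial functions *)

Section euclidean_norm.
Context {R : realType} {k : nat}.
Implicit Types (x y z u v w : 'rV[R]_k) (a c : R).

Lemma dotpC x y : dotp x y = dotp y x.
Proof. by apply: eq_bigr => i _; rewrite mulrC. Qed.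

Lemma dotpDr x y z : dotp x (y + z) = dotp x y + dotp x z.
Proof.
by rewrite /dotp -big_split; apply: eq_bigr => i _; rewrite mxE mulrDr.
Qed.

Lemma dotpZr a x y : dotp x (a *: y) = a * dotp x y.
Proof. by rewrite /dotp mulr_sumr; apply: eq_bigr => i _; rewrite mxE mulrCA. Qed.

Lemma dotpDl x y z : dotp (x + y) z = dotp x z + dotp y z.
Proof. by rewrite !(dotpC _ z) dotpDr. Qed.

Lemma dotpZl a x y : dotp (a *: x) y = a * dotp x y.
Proof. by rewrite !(dotpC _ y) dotpZr. Qed.

Lemma dotp0 x : dotp 0 x = 0.
Proof. by rewrite -(scale0r 0) dotpZl mul0r. Qed.

Lemma dotp_delta x i : dotp x (delta_mx 0 i) = x 0 i.
Proof.
rewrite /dotp (bigD1 i)//= big1 => [|j ji]; rewrite mxE ?eqxx ?mulr1 ?addr0//.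
by rewrite (negbTE ji) mulr0.
Qed.

Lemma dotp_ge0 x : 0 <= dotp x x.
Proof. by apply: sumr_ge0 => i _; rewrite -expr2 sqr_ge0. Qed.

Lemma enorm_ge0 x : 0 <= enorm x.
Proof. exact: sqrtr_ge0. Qed.

Lemma sqr_enorm x : enorm x ^+ 2 = dotp x x.
Proof. by rewrite sqr_sqrtr ?dotp_ge0. Qed.

Lemma enorm0 : enorm (0 : 'rV[R]_k) = 0.
Proof. by rewrite /enorm dotp0 sqrtr0. Qed.

Lemma coord_le_enorm x i : `|x 0 i| <= enorm x.
Proof.
rewrite -sqrtr_sqr ler_wsqrtr// /dotp (bigD1 i)//= expr2 lerDl.
by apply: sumr_ge0 => j _; rewrite -expr2 sqr_ge0.
Qed.

(** The topology of row vectors is that of the sup norm; this bound and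
    [enorm_le_norm] transfer it to the Euclidean norm. *)
Lemma norm_le_enorm x : `|x| <= enorm x.
Proof.
rewrite [leLHS]/Num.Def.normr/= mx_normrE bigmax_le ?enorm_ge0// => -[i j] _ /=.
by rewrite ord1 coord_le_enorm.
Qed.

Lemma coord_le_norm x i : `|x 0 i| <= `|x|.
Proof.
by rewrite [leRHS]/Num.Def.normr/= mx_normrE; exact: (le_bigmax _ _ (0, i)).
Qed.

Lemma dotp_le_norm x : dotp x x <= k%:R * `|x| ^+ 2.
Proof.
rewrite -[k in k%:R]card_ord -sum1_card natr_sum mulr_suml; apply: ler_sum => i _.
rewrite mul1r -expr2 -real_normK ?num_real//.
by rewrite lerXn2r ?nnegrE// coord_le_norm.
Qed.

Lemma enorm_le_norm x : enorm x <= Num.sqrt k%:R * `|x|.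
Proof.
rewrite -[`|x|]ger0_norm// -[X in _ * X]sqrtr_sqr -sqrtrM ?ler0n//.
by rewrite ler_wsqrtr// dotp_le_norm.
Qed.

Lemma enorm_eq0 x : (enorm x == 0) = (x == 0).
Proof.
apply/idP/eqP => [/eqP x0|->]; last by rewrite enorm0.
by apply/eqP; rewrite -normr_le0 (le_trans (norm_le_enorm x)) ?x0.
Qed.

Lemma enorm_gt0 x : (0 < enorm x) = (x != 0).
Proof. by rewrite lt_def enorm_eq0 enorm_ge0 andbT. Qed.

Lemma enormZ a x : 0 <= a -> enorm (a *: x) = a * enorm x.
Proof.
move=> a0; rewrite /enorm dotpZl dotpZr mulrA -expr2 sqrtrM ?sqr_ge0//.
by rewrite sqrtr_sqr ger0_norm.
Qed.

Lemma enorm_udir x : enorm x *: udir x = x.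
Proof.
have [->|x0] := eqVneq x 0; first by rewrite /udir !scaler0.
by rewrite /udir scalerA divff ?scale1r// enorm_eq0.
Qed.

Lemma udirZ a x : 0 < a -> udir (a *: x) = udir x.
Proof.
by move=> a0; rewrite /udir enormZ ?ltW// invfM scalerA mulrAC mulVf ?gt_eqF// mul1r.
Qed.

Lemma udir0 : udir (0 : 'rV[R]_k) = 0.
Proof. by rewrite /udir scaler0. Qed.

Lemma dotp_udir x : dotp (udir x) x = enorm x.
Proof.
have [->|x0] := eqVneq x 0; first by rewrite udir0 dotp0 enorm0.
by rewrite /udir dotpZl -sqr_enorm expr2 mulKf// enorm_eq0.
Qed.

Lemma dotp_udir1 x : x != 0 -> dotp (udir x) (udir x) = 1.
Proof. by move=> x0; rewrite {2}/udir dotpZr dotp_udir mulVf// enorm_eq0. Qed.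

Lemma norm_udir_le1 x : `|udir x| <= 1.
Proof.
have [->|x0] := eqVneq x 0; first by rewrite udir0 normr0.
by rewrite (le_trans (norm_le_enorm _))// /enorm dotp_udir1// sqrtr1.
Qed.

Lemma dotp_continuous (T : topologicalType) (F G : T -> 'rV[R]_k) (t : T) :
  {for t, continuous F} -> {for t, continuous G} ->
  {for t, continuous (fun s => dotp (F s) (G s))}.
Proof.
move=> cF cG; apply: cvg_big => // [|i _]; first exact: add_continuous.
apply: cvgM.
  by apply: (@continuous_comp _ _ _ F (fun x => x 0 i)) => //; exact: coord_continuous.
by apply: (@continuous_comp _ _ _ G (fun x => x 0 i)) => //; exact: coord_continuous.
Qed.

Lemma enorm_continuous : continuous (@enorm R k).
Proof.
move=> x; apply: (@continuous_comp _ _ _ (fun x => dotp x x) Num.sqrt).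
  by apply: dotp_continuous; exact: cvg_id.
exact: sqrt_continuous.
Qed.

Lemma udir_continuous x : x != 0 -> {for x, continuous (@udir R k)}.
Proof.
move=> x0; have ex0 : enorm x != 0 by rewrite enorm_eq0.
apply: continuousZ; last exact: cvg_id.
exact: continuousV ex0 (@enorm_continuous x).
Qed.

Lemma dotp_is_linear w : linear (dotp w).
Proof. by move=> a x y; rewrite dotpDr dotpZr. Qed.

Lemma dotpl_continuous w : continuous (dotp w).
Proof.
move=> x; apply: (@dotp_continuous _ (cst w) id); first exact: cst_continuous.
exact: cvg_id.
Qed.

Lemma grad_is_diff (g : 'rV[R]_k -> R) x w : is_diff x g (dotp w) -> grad g x = w.
Proof.
by move=> [dg dgE]; apply/rowP => i; rewrite mxE deriveE// dgE dotp_delta.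
Qed.

Lemma is_diff_grad (g : 'rV[R]_k -> R) x :
  differentiable g x -> is_diff x g (dotp (grad g x)).
Proof.
move=> gx; apply: DiffDef => //; apply/funext => v.
rewrite {1}(row_sum_delta v) linear_sum; apply: eq_bigr => i _.
by rewrite linearZ /= mxE deriveE// mulrC.
Qed.

Lemma is_diff_dotp x : is_diff x (fun y => dotp y y) (dotp (2 *: x)).
Proof.
apply: is_diff_epsilon.
- exact: dotp_is_linear.
- exact: dotpl_continuous.
move=> e e0; have k0 : 0 < 1 + k%:R :> R by rewrite ltr_pwDl.
have ek : 0 < (1 + k%:R)^-1 * e by rewrite mulr_gt0 ?invr_gt0.
apply: filterS (nbhs0_le ek) => v vek.
rewrite (_ : _ - _ - _ = dotp v v); last first.
  by rewrite !dotpDl !dotpDr dotpZl (dotpC v x); ring.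
rewrite ger0_norm ?dotp_ge0// (le_trans (dotp_le_norm v))// expr2 mulrA.
apply: ler_wpM2r => //.
apply: (@le_trans _ _ ((1 + k%:R) * `|v|)); first by rewrite ler_wpM2r// lerDr.
by rewrite -ler_pdivlMl.
Qed.

Section radial_function.
Variables g dg : R -> R.
Hypothesis gE : forall s : R, is_derive s 1 g (dg s).
Hypothesis dg_cont : continuous dg.
Hypothesis dg0 : dg 0 = 0.

(** Away from the origin this is the chain rule through the square root of the
    polynomial |x|^2.  At the origin the norm is not differentiable, but g' tends to
    0, hence g(|v|) - g(0) = o(|v|) by the mean value theorem. *)
Lemma radial_is_diff x :
  is_diff x (fun y => g (enorm y)) (dotp (dg (enorm x) *: udir x)).
Proof.
have [->|x0] := eqVneq x 0.
  rewrite enorm0 dg0 scale0r; apply: is_diff_epsilon.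
  - exact: dotp_is_linear.
  - exact: dotpl_continuous.
  move=> e e0.
  set C : R := 1 + Num.sqrt k%:R.
  have C0 : 0 < C by rewrite ltr_pwDl ?sqrtr_ge0.
  have eC : 0 < e / C by rewrite divr_gt0.
  have /cvgrPdist_le/(_ _ eC)/nbhs_ballP[d /= d0 dH] := @dg_cont 0.
  have dC : 0 < C^-1 * d by rewrite mulr_gt0 ?invr_gt0.
  apply: filterS (nbhs0_lt dC) => v vd; rewrite dotp0 addr0 enorm0 subr0.
  have [c] := @mvt_dist _ g dg 0 (enorm v) (is_derive_continuous gE) (fun t _ => gE t).
  rewrite !subr0 [`|enorm v|]ger0_norm ?enorm_ge0// => cv ->.
  have vC : enorm v <= C * `|v|.
    by rewrite (le_trans (enorm_le_norm v))// ler_wpM2r// lerDr.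
  rewrite normrM [`|enorm v|]ger0_norm ?enorm_ge0//.
  apply: (@le_trans _ _ (e / C * (C * `|v|))); last by rewrite mulrA divfK ?gt_eqF.
  apply: ler_pM => //; first exact: enorm_ge0.
  have := dH c; rewrite /= dg0 sub0r normrN; apply.
  by rewrite /ball/= sub0r normrN (le_lt_trans (le_trans cv vC))// -ltr_pdivlMl.
have s0 : 0 < dotp x x by rewrite -sqr_enorm exprn_gt0 ?enorm_gt0.
have := is_derive1_sqrt s0 => ds.
have := @is_derive1_comp R g Num.sqrt (dotp x x) _ _ (gE _) ds => -[dE Ed].
have gs : is_diff (dotp x x) (g \o Num.sqrt)
    (fun h => h *: (dg (enorm x) / (2 * enorm x))).
  apply: DiffDef; first exact/derivable1_diffP.
  by rewrite diff1E ?derive1E ?Ed//; exact/derivable1_diffP.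
have dx := is_diff_dotp x.
have := @is_diff_comp R _ _ _ (fun y => dotp y y) _ (g \o Num.sqrt) _ x dx gs.
move=> /is_diff_eq; apply; apply/funext => v /=.
rewrite dotpZl [in RHS]dotpZl /udir dotpZl /GRing.scale/=.
by field; rewrite enorm_eq0.
Qed.

(** The direction jumps at the origin but stays bounded, and dg vanishes there. *)
Lemma radial_grad_continuous : continuous (fun x => dg (enorm x) *: udir x).
Proof.
move=> x; have dgc : {for x, continuous (fun x => dg (enorm x))}.
  by apply: (@continuous_comp _ _ _ _ dg); [exact: enorm_continuous|exact: dg_cont].
have [x0|x0] := eqVneq x 0; last exact: continuousZ dgc (udir_continuous x0).
apply: scale_bounded_continuous => //; last exact: norm_udir_le1.
by rewrite x0 enorm0.
Qed.

End radial_function.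

End euclidean_norm.

(** * Jacobian of a radial map and gradient of the transformed density *)

(** The matrix determinant lemma: the block matrix with rows (1, -v) and (u^T, a)
    is made triangular by clearing the lower left block from the left, which leaves
    a + u^T v, or from the right, which leaves 1 + v u^T / a. *)
Lemma det_scalar_rank1 (F : fieldType) (n : nat) (a : F) (u v : 'rV[F]_n) :
  a != 0 -> \det (a%:M + u^T *m v) = a ^+ n * (1 + a^-1 * (v *m u^T) 0 0).
Proof.
move=> a0; pose B : 'M[F]_(1 + n) := block_mx 1%:M (- v) u^T a%:M.
have <- : \det B = \det (a%:M + u^T *m v).
  have : \det (block_mx 1%:M 0 (- u^T) 1%:M *m B) = \det (a%:M + u^T *m v).
    rewrite mulmx_block !mul1mx !mul0mx !addr0 mulmx1 addNr det_ublock det1 mul1r.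
    by rewrite mulmxN mulNmx opprK addrC.
  by rewrite det_mulmx det_lblock !det1 !mul1r.
have : \det (B *m block_mx 1%:M 0 (- (a^-1 *: u^T)) 1%:M) =
    a ^+ n * (1 + a^-1 * (v *m u^T) 0 0).
  rewrite mulmx_block !mulmx0 !mulmx1 !add0r.
  rewrite mulmxN mulNmx opprK mul_scalar_mx scalerN scalerA divff// scale1r subrr.
  by rewrite det_ublock det_scalar mulrC det_mx11 -scalemxAr !mxE eqxx.
by rewrite det_mulmx det_lblock !det1 !mulr1.
Qed.

Section radial_map.
Context {R : realType} {k : nat}.
Variables f df d2f : R -> R.
Hypothesis k_gt0 : (0 < k)%N.
Hypothesis fP : radial_profile f df d2f.
Implicit Types (x v : 'rV[R]_k) (s : R).

Local Notation phi := (ratio f df).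
Local Notation dphi := (dratio f df).

Lemma radial_ratio x : radial f x = phi (enorm x) *: x.
Proof.
rewrite /radial /udir; case: eqVneq => [->|x0]; first by rewrite scaler0.
by rewrite scalerA /ratio enorm_eq0 (negbTE x0).
Qed.

Let phi_gt0 s : 0 < phi s. Proof. exact: ratio_gt0 fP s. Qed.

Let phi_is_derive s : is_derive s 1 phi (dphi s).
Proof. exact: ratio_is_derive fP s. Qed.

Let dphi_continuous : continuous dphi.
Proof. exact: dratio_continuous fP. Qed.

Let df_gt0 s : 0 < df s := rp_derive_gt0 fP s.

Let dfE s : is_derive s 1 df (d2f s) := rp_is_derive2 fP s.

Let dphi0 : dphi 0 = 0. Proof. by rewrite /dratio eqxx. Qed.

Lemma radial_map_is_diff x : is_diff x (radial f)
  (fun v => phi (enorm x) *: v + dotp (dphi (enorm x) *: udir x) v *: x).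
Proof.
rewrite (_ : radial f = fun x => phi (enorm x) *: x); last exact/funext/radial_ratio.
exact: is_diff_scale_id (radial_is_diff phi_is_derive dphi_continuous dphi0 x).
Qed.

Lemma radial_map_continuous : continuous (radial f : 'rV[R]_k -> 'rV[R]_k).
Proof.
move=> x; apply: differentiable_continuous.
by have [] := radial_map_is_diff x.
Qed.

(** The radial direction is stretched by f'(s), the k - 1 tangential ones by
    f(s) / s. *)
Definition radial_jac s := df s * phi s ^+ k.-1.

Definition dradial_jac s :=
  d2f s * phi s ^+ k.-1 + df s * (k.-1%:R * phi s ^+ k.-2 * dphi s).

(** The Jacobian at x is phi 1 + (phi' u)^T x with u = x / |x|, a rank-one
    perturbation of a scalar matrix. *)
Lemma det_jacobian_radial x : \det ('J (radial f) x) = radial_jac (enorm x).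
Proof.
have [_ dE] := radial_map_is_diff x.
have -> : 'J (radial f) x =
    (phi (enorm x))%:M + (dphi (enorm x) *: udir x)^T *m x.
  apply/matrixP => i j; rewrite /jacobian mxE dE dotp_delta !mxE big_ord1 !mxE.
  by rewrite eqxx /= [j == i]eq_sym mulr_natr.
rewrite det_scalar_rank1 ?gt_eqF// linearZ -scalemxAr mxE /radial_jac.
have -> : (x *m (udir x)^T) 0 0 = enorm x.
  by rewrite -dotp_udir dotpC mxE; apply: eq_bigr => i _; rewrite mxE.
rewrite -(ratio_dratio f df).
have -> : phi (enorm x) ^+ k = phi (enorm x) * phi (enorm x) ^+ k.-1.
  by rewrite -exprS prednK.
by field; rewrite gt_eqF.
Qed.

Lemma radial_jac_gt0 s : 0 < radial_jac s.
Proof. by rewrite mulr_gt0 ?exprn_gt0. Qed.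

Lemma radial_jac_is_derive s : is_derive s 1 radial_jac (dradial_jac s).
Proof.
have := is_deriveX k.-1 (phi_is_derive s); have := dfE s; rewrite exprfctE => ? ?.
rewrite /radial_jac /dradial_jac; apply: is_derive_eq.
by rewrite /GRing.scale/=; ring.
Qed.

Lemma dradial_jac_continuous : continuous dradial_jac.
Proof.
have phic n : continuous (fun s => phi s ^+ n).
  move=> s; apply: (@continuous_comp _ _ _ phi (fun t : R => t ^+ n)).
    exact: is_derive_continuous phi_is_derive _.
  exact: exprn_continuous.
move=> s; apply: cvgD; apply: cvgM.
- exact: rp_continuous2 fP _.
- exact: phic.
- exact: is_derive_continuous dfE _.
- apply: cvgM; last exact: dphi_continuous.
  by apply: cvgM; [exact: cvg_cst|exact: phic].
Qed.

Lemma dradial_jac0 : dradial_jac 0 = 0.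
Proof. by rewrite /dradial_jac (rp_derive2_0 fP) dphi0 mul0r !mulr0 addr0. Qed.

Lemma dradial_jac_ratio s :
  dradial_jac s / radial_jac s = d2f s / df s + k.-1%:R * (dphi s / phi s).
Proof.
have d0 := df_gt0 s; have p0 := phi_gt0 s.
rewrite /dradial_jac /radial_jac; case: k k_gt0 => [//|[|n]] _ /=.
  by rewrite !mul0r mulr0 !addr0 expr0 !mulr1.
rewrite exprS; field.
by rewrite !gt_eqF// exprn_gt0.
Qed.

Section density.
Variable pi : 'rV[R]_k -> R.
Hypothesis piC1 : positive_C1 pi.

Lemma transformed_density_radial x :
  transformed_density pi (radial f) x = pi (radial f x) * radial_jac (enorm x).
Proof.
by rewrite /transformed_density det_jacobian_radial gtr0_norm ?radial_jac_gt0.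
Qed.

Definition transformed_grad x : 'rV[R]_k :=
  radial_jac (enorm x) *:
    (phi (enorm x) *: grad pi (radial f x)
     + dotp (grad pi (radial f x)) x *: (dphi (enorm x) *: udir x))
  + pi (radial f x) *: (dradial_jac (enorm x) *: udir x).

Lemma transformed_density_is_diff x :
  is_diff x (transformed_density pi (radial f)) (dotp (transformed_grad x)).
Proof.
rewrite (_ : transformed_density pi (radial f) = (pi \o radial f) *
  (fun x => radial_jac (enorm x))); last exact/funext/transformed_density_radial.
have [_ [piD _]] := piC1.
have dpi := is_diff_grad (piD (radial f x)).
have dh := radial_map_is_diff x.
have dj := radial_is_diff radial_jac_is_derive dradial_jac_continuous dradial_jac0 x.
have := is_diffM (is_diff_comp dh dpi) dj.
move/is_diff_eq; apply; apply/funext => v /=.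
rewrite /transformed_grad !fctE/= !(dotpDl, dotpDr, dotpZl, dotpZr).
by rewrite /GRing.scale/=; ring.
Qed.

Lemma transformed_grad_continuous : continuous transformed_grad.
Proof.
have [_ [piD gradc]] := piC1.
have pic : continuous pi by move=> x; exact: differentiable_continuous.
have hc := radial_map_continuous.
have ec (F : R -> R) x : continuous F -> {for x, continuous (fun y : 'rV[R]_k => F (enorm y))}.
  move=> Fc; apply: (@continuous_comp _ _ _ _ F); first exact: enorm_continuous.
  exact: Fc.
have gc x : {for x, continuous (fun y => grad pi (radial f y))}.
  by apply: (@continuous_comp _ _ _ (radial f) (grad pi)); [exact: hc|exact: gradc].
move=> x; change {for x, continuous transformed_grad}; rewrite /transformed_grad.
apply: continuous_add; apply: continuousZ.
- by apply: ec; exact: is_derive_continuous radial_jac_is_derive.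
- apply: continuous_add; apply: continuousZ.
  + by apply: ec; exact: is_derive_continuous phi_is_derive.
  + exact: gc.
  + by apply: dotp_continuous; [exact: gc|exact: cvg_id].
  + exact: (@radial_grad_continuous R k dphi dphi_continuous dphi0).
- by apply: (@continuous_comp _ _ _ (radial f) pi); [exact: hc|exact: pic].
- exact: (@radial_grad_continuous R k dradial_jac dradial_jac_continuous dradial_jac0).
Qed.

Lemma transformed_density_C1 : positive_C1 (transformed_density pi (radial f)).
Proof.
split=> [x|]; first by rewrite transformed_density_radial mulr_gt0 ?radial_jac_gt0// piC1.1.
split=> [x|]; first by have [] := transformed_density_is_diff x.
rewrite (_ : grad _ = transformed_grad); first exact: transformed_grad_continuous.
by apply/funext => x; exact/grad_is_diff/transformed_density_is_diff.
Qed.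

End density.
End radial_map.

Arguments radial_jac {R} k f df s.
Arguments dradial_jac {R} k f df d2f s.

(** * The curvature condition *)

Section curvature.
Context {R : realType} {k : nat}.
Implicit Types (x u v : 'rV[R]_k) (pi : 'rV[R]_k -> R).

Lemma limsup_infty_le (g : 'rV[R]_k -> R) (M c : R) :
  (forall x, M < enorm x -> g x <= c) -> (limsup_infty g <= c%:E)%E.
Proof.
move=> gc; pose A : set 'rV[R]_k := [set x | M < enorm x].
apply: (@le_trans _ _ (ereal_sup ((fun x => (g x)%:E) @` A))).
  by apply: ereal_inf_lbound; exists A => //; exists M.
by apply: ge_ereal_sup => _ [x Ax <-]; rewrite lee_fin gc.
Qed.

Lemma dotp_udir_le (u v : 'rV[R]_k) : dotp u v < 0 ->
  dotp v v <= (2 * dotp u v) ^+ 2 -> dotp u (udir v) <= - 2^-1.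
Proof.
move=> uv0 vv.
have v0 : 0 < enorm v.
  rewrite enorm_gt0; apply/eqP => v0.
  by move: uv0; rewrite v0 dotpC dotp0 ltxx.
have ev : enorm v <= - (2 * dotp u v).
  rewrite -(@ler_pXn2r _ 2) ?nnegrE ?enorm_ge0//; last lra.
  by rewrite sqr_enorm sqrrN.
rewrite /udir dotpZr mulrC ler_pdivrMr//; lra.
Qed.

(** In the orthogonal decomposition of a g + c u along the unit vector u, the part
    across u has norm at most a |g|.  If the part along u is negative and at least as
    long, the vector lies within 45 degrees of -u, so its cosine with u is below
    -1/2. *)
Lemma dotp_udir_combine (u g : 'rV[R]_k) (a c : R) : dotp u u = 1 ->
  a * dotp u g + c < 0 -> 0 <= a -> a * enorm g <= - (a * dotp u g + c) ->
  dotp u (udir (a *: g + c *: u)) <= - 2^-1.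
Proof.
move=> uu; set A := a * _ + c => A0 a0 gA.
have AE : dotp u (a *: g + c *: u) = A by rewrite dotpDr !dotpZr uu mulr1.
apply: dotp_udir_le; rewrite AE//.
have gg : a ^+ 2 * dotp g g <= A ^+ 2.
  rewrite -sqr_enorm -exprMn -[A ^+ 2]sqrrN lerXn2r ?nnegrE//; last lra.
  by rewrite mulr_ge0 ?enorm_ge0.
have -> : dotp (a *: g + c *: u) (a *: g + c *: u) =
    A ^+ 2 + a ^+ 2 * (dotp g g - dotp u g ^+ 2).
  by rewrite !(dotpDl, dotpDr, dotpZl, dotpZr) uu (dotpC g u) /A; ring.
have := sqr_ge0 (a * dotp u g); have := sqr_ge0 A; nra.
Qed.

Lemma grad_logE pi x : positive_C1 pi -> grad_log pi x = (pi x)^-1 *: grad pi x.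
Proof.
move=> [pi0 [piD _]]; apply: grad_is_diff.
have [dln Eln] := is_derive1_ln (pi0 x).
have lnx : is_diff (pi x) (@ln R) (fun h => h *: (pi x)^-1).
  apply: DiffDef; first exact/derivable1_diffP.
  by rewrite diff1E ?derive1E ?Eln//; exact/derivable1_diffP.
have := is_diff_comp (is_diff_grad (piD x)) lnx.
move/is_diff_eq; apply; apply/funext => v /=.
by rewrite dotpZl /GRing.scale/= mulrC.
Qed.

Variables f df d2f : R -> R.
Hypothesis k_gt0 : (0 < k)%N.
Hypothesis fP : radial_profile f df d2f.

Lemma udir_radial x : 0 < f (enorm x) -> udir (radial f x) = udir x.
Proof.
have [->|x0] := eqVneq x 0; first by rewrite enorm0 (rp0 fP) ltxx.
move=> fx; rewrite (radial_ratio _ df) udirZ//.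
exact: ratio_gt0 fP _.
Qed.

Lemma enorm_radial x : 0 <= f (enorm x) -> enorm (radial f x) = f (enorm x).
Proof.
move=> fx; rewrite (radial_ratio _ df) enormZ ?(ratioM fP)//.
by apply/ltW; exact: ratio_gt0 fP _.
Qed.

(** With phi(s) = f(s) / s, the left-hand side is phi'/phi = f'/f - 1/s. *)
Lemma dratio_ratio_le (s : R) : 0 < s -> dratio f df s / ratio f df s <= df s / f s.
Proof.
move=> s0; have p0 := ratio_gt0 fP s.
rewrite -(ratio_dratio f df s) -(ratioM fP s).
rewrite [leRHS](_ : _ = s^-1 + dratio f df s / ratio f df s).
  by rewrite lerDr invr_ge0 ltW.
by field; rewrite !gt_eqF.
Qed.

(** With g = grad log pi at the image point, the gradient of the logarithm of the
    transformed density is a combination of g and u = x / |x| whose radial component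
    is A = f' (u . g) + (log J)', where J is the Jacobian determinant as a function
    of the radius. *)
Lemma cos_transformed_grad_le pi x : positive_C1 pi -> x != 0 ->
  let s := enorm x in
  let g := grad_log pi (radial f x) in
  let A := df s * dotp (udir x) g + dradial_jac k f df d2f s / radial_jac k f df s in
  A < 0 -> ratio f df s * enorm g <= - A ->
  dotp (udir x) (udir (grad (transformed_density pi (radial f)) x)) <= - 2^-1.
Proof.
move=> piC1 x0 s g A A0 gA.
have T := transformed_density_is_diff k_gt0 fP piC1 x.
rewrite (grad_is_diff T).
set u := udir x in A A0 gA *.
have jac0 := radial_jac_gt0 (k := k) fP s.
have pi0 := piC1.1 (radial f x).
pose c := dotp g x * dratio f df s + dradial_jac k f df d2f s / radial_jac k f df s.
have -> : transformed_grad f df d2f pi x = (pi (radial f x) * radial_jac k f df s) *: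
    (ratio f df s *: g + c *: u).
  rewrite /transformed_grad /g grad_logE// /c /g grad_logE// -/s -/u.
  apply/rowP => i; rewrite dotpZl !mxE; field.
  by rewrite enorm_eq0 x0 !gt_eqF//.
rewrite (udirZ _ (mulr_gt0 pi0 jac0)).
have AE : ratio f df s * dotp u g + c = A.
  rewrite /c /A -[x in dotp g x](enorm_udir x) dotpZr -/s (dotpC g) -/u.
  by rewrite -(ratio_dratio f df); ring.
apply: dotp_udir_combine; rewrite ?AE//; first exact: dotp_udir1.
by apply/ltW; exact: ratio_gt0 fP _.
Qed.

End curvature.

Lemma radial_f2_f1 (R : realType) (k : nat) (r p b : R) :
  0 <= r -> 2 < p -> 0 < b ->
  radial (f2 b) \o radial (f1 r p) = radial (profile r p b) :> ('rV[R]_k -> 'rV[R]_k).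
Proof.
move=> r0 p2 b0; apply/funext => x /=; rewrite /radial.
have [_|x0] := eqVneq x 0; first by rewrite eqxx.
have s0 : 0 < enorm x by rewrite enorm_gt0.
have f0 : 0 < f1 r p (enorm x) by exact: lt_le_trans (f1_ge _ _ _).
have e1 : enorm (udir x) = 1 by rewrite /enorm dotp_udir1 ?sqrtr1.
rewrite scaler_eq0 gt_eqF//= -enorm_eq0 e1 oner_eq0.
rewrite udirZ// enormZ ?ltW// e1 mulr1 /profile.
by congr (_ *: _); rewrite /udir e1 invr1 scale1r.
Qed.

Theorem corollary2 (R : realType) (k : nat) (pi_beta : 'rV[R]_k -> R)
  (r p b : R)
  (k_ge1 : (1 <= k)%N)
  (pi_beta_C1 : positive_C1 pi_beta)
  (pi_beta_mass : unit_mass pi_beta)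
  (pi_beta_light : sub_exponentially_light pi_beta)
  (pi_beta_upper : exists alpha1 R1 : R, k%:R < alpha1 /\
     forall x : 'rV[R]_k, R1 < enorm x ->
       dotp (udir x) (grad_log pi_beta x) <= - (alpha1 / enorm x))
  (pi_beta_bound : exists alpha2 R2 : R, k%:R < alpha2 /\
     forall x : 'rV[R]_k, R2 < enorm x ->
       enorm (grad_log pi_beta x) <= alpha2 / enorm x)
  (r_ge0 : 0 <= r) (p_gt2 : 2 < p) (b_gt0 : 0 < b) :
  let h1 := radial (f1 r p) in
  let h2 := radial (f2 b) in
  let pi_gamma := transformed_density pi_beta (h2 \o h1) in
  positive_C1 pi_gamma /\ curvature_condition pi_gamma.
Proof.
move=> h1 h2 pi_gamma; rewrite /pi_gamma /h1 /h2 radial_f2_f1//.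
have fP := profile_radial r_ge0 p_gt2 b_gt0.
pose f := profile r p b; pose df := dprofile r p b; pose d2f := d2profile r p b.
rewrite -/f -/df -/d2f in fP *.
have df_gt0 s : 0 < df s := rp_derive_gt0 fP s.
split; first exact: (transformed_density_C1 k_ge1 fP).
have [a1 [R1 [ka1 H1]]] := pi_beta_upper.
have [a2 [R2 [ka2 H2]]] := pi_beta_bound.
have k1 : 1 <= k%:R :> R by rewrite ler1n.
have bV : 0 < b^-1 by rewrite invr_gt0.
have a1k : 0 < (a1 - k%:R) * b by rewrite mulr_gt0// subr_gt0.
have e0 := expR_gt0 (1 : R).
(* In order: the exponential branch is reached, s - r >= 1, the tangential part is
   at most 1, the radial part is at most -1, and f s exceeds R1 and R2. *)
pose M := b^-1 + (r + 1) + a2 + p / ((a1 - k%:R) * b)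
  + (`|R1| + `|R2| + expR 1) / b.
suff : (limsup_infty (fun x => dotp (udir x)
    (udir (grad (transformed_density pi_beta (radial f)) x))) <= (- 2^-1)%:E)%E.
  by move/le_lt_trans; apply; rewrite lte_fin oppr_lt0 invr_gt0.
apply: (@limsup_infty_le _ _ _ M) => x; set s := enorm x => Ms.
have q0 : 0 < p / ((a1 - k%:R) * b) by rewrite divr_gt0//; lra.
have n0 : 0 <= (`|R1| + `|R2| + expR 1) / b.
  by rewrite divr_ge0 ?ltW// addr_ge0// ?addr_ge0// ltW.
have s0 : 0 < s by rewrite /M in Ms; lra.
have bs : b^-1 < s by rewrite /M in Ms; lra.
have rs : r + 1 <= s by rewrite /M in Ms; lra.
have a2s : a2 <= s by rewrite /M in Ms; lra.
have ps : p <= (a1 - k%:R) * b * (s - r).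
  by rewrite -ler_pdivrMl// mulrC; rewrite /M in Ms; lra.
have fs : `|R1| + `|R2| < f s.
  apply: lt_le_trans (profile_ge r p b_gt0 bs).
  rewrite ltrBrDr mulrC -ltr_pdivrMr//; rewrite /M in Ms; lra.
have f_gt0 : 0 < f s by rewrite (le_lt_trans _ fs)// addr_ge0.
have hx : enorm (radial f x) = f s.
  by rewrite (enorm_radial fP)// ltW.
have R1f : R1 < f s by have := ler_norm R1; have := normr_ge0 R2; lra.
have R2f : R2 < f s by have := ler_norm R2; have := normr_ge0 R1; lra.
have {H1} := H1 (radial f x); rewrite hx => /(_ R1f).
have {H2} := H2 (radial f x); rewrite hx => /(_ R2f).
rewrite (udir_radial fP)//.
set g := grad_log _ _ => gn ug.
have [g1 g2] := profile_far r_ge0 p_gt2 b_gt0 bs rs.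
rewrite -/f -/df -/d2f in g1 g2.
have x0 : x != 0 by rewrite -enorm_gt0.
set A := df s * dotp (udir x) g
  + dradial_jac k f df d2f s / radial_jac k f df s.
(* A <= (- a1 + 1 + (k - 1)) f'/f + (p - 1): the logarithm of the Jacobian determinant
   contributes at most k f'/f up to a constant. *)
have A1 : A <= - 1.
  have t1 : df s * dotp (udir x) g <= - a1 * (df s / f s).
    rewrite (le_trans (ler_wpM2l (ltW (df_gt0 s)) ug))// le_eqVlt; apply/orP; left.
    by apply/eqP; ring.
  have := dratio_ratio_le fP s0.
  rewrite /A (dradial_jac_ratio k_ge1 fP).
  have -> : k.-1%:R = k%:R - 1 :> R by rewrite -subn1 natrB.
  set w := dratio _ _ _ / _ => ww.
  have t2 : (k%:R - 1) * w <= (k%:R - 1) * (df s / f s) by rewrite ler_wpM2l// subr_ge0.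
  have t3 : (a1 - k%:R) * (b * (s - r)) <= (a1 - k%:R) * (df s / f s).
    by rewrite ler_pM2l// subr_gt0.
  lra.
apply: (cos_transformed_grad_le k_ge1 fP pi_beta_C1 x0).
  by rewrite -/A; lra.
rewrite -/A -/s -/g; apply: (@le_trans _ _ 1); last lra.
apply: (@le_trans _ _ (ratio f df s * (a2 / f s))).
  by rewrite ler_wpM2l// ltW//; exact: ratio_gt0 fP _.
rewrite /ratio gt_eqF// (_ : _ * _ = a2 / s); first by rewrite ler_pdivrMr// mul1r.
by field; rewrite !gt_eqF.
Qed.
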